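(* $\Xi(4)=5$. More precisely, $\mathfrak{Gr}(n,4)=\emptyset$ for all $n\ge 6$; up to isomorphism, $\mathfrak{Gr}(4,4)$ consists exactly of the cycle $C_4$, the path $P_4$ on 4 vertices, the star $K_{1,3}$, the edgeless graph $E_4$ on 4 vertices, and the disjoint union of the path $P_3$ on 3 vertices with an isolated vertex; and $\mathfrak{Gr}(5,4)$ consists exactly of the cycle $C_5$, the complete bipartite graph $K_{2,3}$, the star $K_{1,4}$, and the graph obtained from a 4-cycle by attaching one new vertex of degree 1 to one of its vertices.
   Context: All graphs are finite, simple and undirected. For a graph $G=(V,E)$ and $x\in V$, $N[x]=\{x\}\cup\{y: xy\in E\}$. A set $C\subseteq V$ is identifying if $N[x]\cap C\ne\emptyset$ for every $x\in V$ and $N[x]\cap C\neq N[y]\cap C$ for all distinct $x,y\in V$. For $n\ge k\ge1$, $\mathfrak{Gr}(n,k)$ is the set of graphs on $n$ vertices in which every $k$-element subset of vertices is identifying, and $\Xi(k)=\max\{n\ge k:\mathfrak{Gr}(n,k)\ne\emptyset\}$. *)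

(* Defs.v *)
From mathcomp Require Import all_boot.

Set Implicit Arguments.
Unset Strict Implicit.
Unset Printing Implicit Defensive.

Record sgraph := SGraph {
  svertex :> finType;
  sedge : rel svertex;
  sedge_sym : symmetric sedge;
  sedge_irrefl : irreflexive sedge }.

Definition closed_nbh (G : sgraph) (x : G) : {set G} :=
  [set y | (y == x) || sedge x y].

Definition identifying (G : sgraph) (C : {set G}) : Prop :=
  (forall x : G, closed_nbh x :&: C != set0) /\
  (forall x y : G, x != y -> closed_nbh x :&: C != closed_nbh y :&: C).

Definition Gr (n k : nat) (G : sgraph) : Prop :=
  #|G| = n /\ forall C : {set G}, #|C| = k -> identifying C.

(* [is_Xi k m] states that the maximum defining Xi(k) exists and equals m. *)
Definition is_Xi (k m : nat) : Prop :=
  (k <= m /\ exists G, Gr m k G) /\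
  (forall n, k <= n -> (exists G, Gr n k G) -> n <= m).

Definition isomorphic (G H : sgraph) : Prop :=
  exists2 f : G -> H, bijective f &
    forall x y : G, sedge (f x) (f y) = sedge x y.

Section EdgelessGraph.
Variable n : nat.

Definition edgeless_rel : rel 'I_n := fun _ _ => false.

Fact edgeless_sym : symmetric edgeless_rel. Proof. by []. Qed.
Fact edgeless_irrefl : irreflexive edgeless_rel. Proof. by []. Qed.

Definition edgeless_graph : sgraph := SGraph edgeless_sym edgeless_irrefl.
End EdgelessGraph.

Section PathGraph.
Variable n : nat.

Definition path_rel : rel 'I_n := fun i j => (i.+1 == j) || (j.+1 == i).

Fact path_sym : symmetric path_rel.
Proof. by move=> i j; rewrite /path_rel orbC. Qed.
Fact path_irrefl : irreflexive path_rel.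
Proof. by move=> i; rewrite /path_rel orbb gtn_eqF. Qed.

Definition path_graph : sgraph := SGraph path_sym path_irrefl.
End PathGraph.

Section CycleGraph.
Variable n : nat.

(* [ordS] is the cyclic successor; this is the cycle C_n for n >= 3.  The *)
(* condition [i != j] only matters for n = 1, where [ordS i = i].         *)
Definition cycle_rel : rel 'I_n :=
  fun i j => (i != j) && ((j == ordS i) || (i == ordS j)).

Fact cycle_sym : symmetric cycle_rel.
Proof. by move=> i j; rewrite /cycle_rel eq_sym orbC. Qed.
Fact cycle_irrefl : irreflexive cycle_rel.
Proof. by move=> i; rewrite /cycle_rel eqxx. Qed.

Definition cycle_graph : sgraph := SGraph cycle_sym cycle_irrefl.
End CycleGraph.

Section CompleteBipartite.
Variables m n : nat.

Definition bipartite_rel : rel ('I_m + 'I_n)%type := fun u v =>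
  match u, v with
  | inl _, inr _ | inr _, inl _ => true
  | _, _ => false
  end.

Fact bipartite_sym : symmetric bipartite_rel. Proof. by case=> i [] j. Qed.
Fact bipartite_irrefl : irreflexive bipartite_rel. Proof. by case. Qed.

Definition complete_bipartite : sgraph :=
  SGraph bipartite_sym bipartite_irrefl.
End CompleteBipartite.

Definition star_graph (n : nat) : sgraph := complete_bipartite 1 n.

Section DisjointUnion.
Variables G H : sgraph.

Definition union_rel : rel (G + H)%type := fun u v =>
  match u, v with
  | inl x, inl y => sedge x y
  | inr x, inr y => sedge x y
  | _, _ => false
  end.

Fact union_sym : symmetric union_rel.
Proof. by case=> x [] y //=; apply: sedge_sym. Qed.
Fact union_irrefl : irreflexive union_rel.
Proof. by case=> x; apply: sedge_irrefl. Qed.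

Definition disjoint_union : sgraph := SGraph union_sym union_irrefl.
End DisjointUnion.

Section Pendant.
Variables (G : sgraph) (v : G).

(* The new vertex is [None]; its only neighbour is [Some v]. *)
Definition pendant_rel : rel (option G) := fun a b =>
  match a, b with
  | Some x, Some y => sedge x y
  | Some x, None | None, Some x => x == v
  | None, None => false
  end.

Fact pendant_sym : symmetric pendant_rel.
Proof. by case=> [x|] [y|] //=; apply: sedge_sym. Qed.
Fact pendant_irrefl : irreflexive pendant_rel.
Proof. by case=> [x|] //; apply: sedge_irrefl. Qed.

Definition attach_pendant : sgraph := SGraph pendant_sym pendant_irrefl.
End Pendant.

(* Main.v *)
Require Import Defs.
From mathcomp Require Import all_boot.

Set Implicit Arguments.
Unset Strict Implicit.
Unset Printing Implicit Defensive.

(** Every k-subset is identifying if and only if fewer than k vertices avoid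
    any given closed neighbourhood, and fewer than k vertices fail to separate
    any two given vertices.  This condition ([spread]) is inherited by induced
    subgraphs, so the labelled graphs satisfying it can be generated one vertex
    at a time, discarding at each step those that violate it.  For k = 4 the
    enumeration dies out at 6 vertices. *)

Definition spread (k : nat) (T : eqType) (e : rel T) (s : seq T) : bool :=
  let nbh x z := (z == x) || e x z in
  all (fun x => (count (fun z => ~~ nbh x z) s < k) &&
    all (fun y => (x == y) || (count (fun z => nbh x z == nbh y z) s < k)) s) s.

(** Serves both to transport the test along an isomorphism and to replace vertices by their
    positions. In the latter use [f] is [nth x0 s], injective only on valid positions, hence the
    hypotheses relative to [s]. *)
Lemma spread_map (k : nat) (T T' : eqType) (f : T -> T') (e : rel T)
    (e' : rel T') (s : seq T) :
  {in s &, injective f} -> {in s &, forall x y, e' (f x) (f y) = e x y} ->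
  spread k e' (map f s) = spread k e s.
Proof.
move=> f_inj ef; rewrite /spread all_map; apply: eq_in_all => x xs /=.
have nbhE y z : y \in s -> z \in s ->
    (f z == f y) || e' (f y) (f z) = (z == y) || e y z.
  by move=> ys zs; rewrite ef // (inj_in_eq f_inj).
congr (_ && _).
  by rewrite count_map; congr (_ < _); apply: eq_in_count => z zs /=; rewrite nbhE.
rewrite all_map; apply: eq_in_all => y ys /=; rewrite (inj_in_eq f_inj) //.
congr (_ || _); rewrite count_map; congr (_ < _).
by apply: eq_in_count => z zs /=; rewrite !nbhE.
Qed.

(** Removing a vertex can only lower the counts and drop conditions; this is what justifies
    pruning. *)
Lemma spread_behead (k : nat) (T : eqType) (e : rel T) (x : T) (s : seq T) :
  spread k e (x :: s) -> spread k e s.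
Proof.
case/andP=> _ /allP sp; apply/allP => y /sp /andP[ny /andP[_ /allP sy]].
apply/andP; split; first exact: leq_ltn_trans (leq_addl _ _) ny.
apply/allP => z /sy /orP[-> // | nz].
by rewrite (leq_ltn_trans (leq_addl _ _) nz) orbT.
Qed.

(** * Identifying sets as hitting sets *)

(** Otherwise the first [k] entries of [s] outside [A] would form a [k]-set missing [A]. *)
Lemma count_notin_lt (T : finType) (A : {set T}) (k : nat) (s : seq T) :
  uniq s -> (forall C : {set T}, #|C| = k -> A :&: C != set0) ->
  count (fun z => z \notin A) s < k.
Proof.
move=> us hit; rewrite ltnNge -size_filter; apply/negP => lek.
set r := filter _ s in lek.
have /hit/set0Pn[z] : #|[set z in take k r]| = k.
  by rewrite cardsE (card_uniqP _) ?size_takel // take_uniq // filter_uniq.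
by rewrite !inE => /andP[zA /mem_take]; rewrite mem_filter zA.
Qed.

Lemma uniq_size_mem (T : finType) (s : seq T) :
  uniq s -> size s = #|T| -> s =i T.
Proof.
move=> /card_uniqP us szs; apply/subset_cardP; first by rewrite us.
exact: subset_predT.
Qed.

(** A set [C] missing [A] would lie among the counted entries, which are too few. *)
Lemma count_notin_hit (T : finType) (A C : {set T}) (s : seq T) :
  uniq s -> size s = #|T| -> count (fun z => z \notin A) s < #|C| ->
  A :&: C != set0.
Proof.
move=> us szs; apply: contraL => /eqP AC0; rewrite -leqNgt -size_filter.
apply: leq_trans (card_size _); apply/subset_leq_card/subsetP => z zC.
rewrite mem_filter (uniq_size_mem us szs) andbT; apply/negP => zA.
by have := in_set0 z; rewrite -AC0 inE zA zC.
Qed.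

(** Turns separation into hitting a symmetric difference, so that one counting argument covers both
    halves of [identifying]. *)
Lemma setI_eq_separator (T : finType) (A B C : {set T}) :
  (A :&: C == B :&: C) = ([set z | (z \in A) != (z \in B)] :&: C == set0).
Proof.
apply/eqP/eqP => [/setP eqAB | /setP eq0]; apply/setP => z.
  by have := eqAB z; rewrite !inE; case: (z \in C); rewrite ?andbF ?andbT // => ->; rewrite eqxx.
by have := eq0 z; rewrite !inE; case: (z \in C); rewrite ?andbF ?andbT // => /negbFE/eqP.
Qed.

(** The list [s] may omit vertices of [G], which allows passing to six vertices of a larger
    graph. *)
Lemma identifying_spread (G : sgraph) (k : nat) (s : seq G) :
  (forall C : {set G}, #|C| = k -> identifying C) -> uniq s ->
  spread k (@sedge G) s.
Proof.
move=> idC us; apply/allP => x _; apply/andP; split.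
  rewrite (eq_count (a2 := fun z => z \notin closed_nbh x)); last first.
    by move=> z; rewrite inE.
  by apply: count_notin_lt => // C /idC[].
apply/allP => y _; case: eqVneq => //= xy.
rewrite (eq_count
  (a2 := fun z => z \notin [set z | (z \in closed_nbh x) != (z \in closed_nbh y)]));
  last by move=> z; rewrite !inE negbK.
apply: count_notin_lt => // C /idC[_ /(_ x y xy)].
by rewrite setI_eq_separator.
Qed.

Lemma spread_Gr (G : sgraph) (k : nat) (s : seq G) :
  uniq s -> size s = #|G| -> spread k (@sedge G) s -> Gr (size s) k G.
Proof.
move=> us szs /allP sp; split=> // C Ck; rewrite -{k}Ck in sp.
have inS := uniq_size_mem us szs.
split=> [x | x y xy]; have /andP[nx /allP sx] := sp x (inS x).
  apply: (count_notin_hit us szs); apply: leq_ltn_trans nx.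
  by rewrite (eq_count (a2 := fun z => z \notin closed_nbh x)) // => z; rewrite inE.
move: (sx y (inS y)); rewrite (negPf xy) /= => nxy; rewrite setI_eq_separator.
apply: (count_notin_hit us szs); apply: leq_ltn_trans nxy.
by apply: sub_count => z; rewrite !inE negbK.
Qed.

Lemma isomorphic_Gr (G H : sgraph) (n k : nat) :
  isomorphic G H -> Gr n k H -> Gr n k G.
Proof.
case=> f [g fK gK] fE [<- idH].
have us : uniq (map g (enum H)) by rewrite (map_inj_uniq (can_inj gK)) enum_uniq.
have szs : size (map g (enum H)) = #|G|.
  by rewrite size_map -cardE; apply: esym (bij_eq_card (Bijective fK gK)).
have szH : size (map g (enum H)) = #|H| by rewrite size_map -cardE.
rewrite -szH; apply: spread_Gr => //.
rewrite (spread_map _ (e := @sedge H)); first exact: identifying_spread idH (enum_uniq _).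
  by move=> x y _ _ /(can_inj gK).
by move=> x y _ _; rewrite -fE !gK.
Qed.

(** * Enumeration of labelled graphs by their codes *)

(* A graph with an ordered vertex set is coded by its strict upper triangular
   adjacency rows: the head row lists the adjacencies of vertex 0 with vertices
   1, 2, ..., and the tail codes the graph on the latter. *)
Fixpoint code (G : sgraph) (s : seq G) : seq bitseq :=
  if s is x :: s' then map (sedge x) s' :: code s' else [::].

Fixpoint adj (m : seq bitseq) (i j : nat) : bool :=
  if m is r :: m' then
    match i, j with
    | 0, 0 => false
    | 0, j'.+1 => nth false r j'
    | i'.+1, 0 => nth false r i'
    | i'.+1, j'.+1 => adj m' i' j'
    end
  else false.

Lemma adj_code (G : sgraph) (x0 : G) (s : seq G) (i j : nat) :
  i < size s -> j < size s ->
  adj (code s) i j = sedge (nth x0 s i) (nth x0 s j).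
Proof.
elim: s i j => [|x s IHs] // [|i] [|j] //= lti ltj; last exact: IHs.
- by rewrite sedge_irrefl.
- by rewrite (nth_map x0).
- by rewrite (nth_map x0) // sedge_sym.
Qed.

(** Regarding [s] as the image of its positions under [nth] moves the test to natural numbers, where
    it can be evaluated. *)
Lemma spread_code (G : sgraph) (k : nat) (s : seq G) :
  uniq s -> spread k (adj (code s)) (iota 0 (size s)) = spread k (@sedge G) s.
Proof.
case: s => // x0 s0; set s := x0 :: s0 => us.
rewrite -[in RHS](mkseq_nth x0 s) (spread_map _ (e := adj (code s))) //.
  by move=> i j; rewrite !mem_iota => lti ltj /eqP; rewrite nth_uniq // => /eqP.
by move=> i j; rewrite !mem_iota => lti ltj; rewrite -adj_code.
Qed.

Fixpoint bitseqs (n : nat) : seq bitseq :=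
  if n is n'.+1 then [seq b :: r | b <- [:: true; false], r <- bitseqs n']
  else [:: [::]].

Lemma mem_bitseqs (r : bitseq) : r \in bitseqs (size r).
Proof. by elim: r => // b r IHr; apply: allpairs_f; rewrite // !inE; case: b. Qed.

(** The new vertex gets number 0 and shifts the others up, so it only adds a head row of length
    [n']. *)
Fixpoint spread_codes (k n : nat) : seq (seq bitseq) :=
  if n is n'.+1 then
    [seq m <- [seq r :: m | m <- spread_codes k n', r <- bitseqs n']
     | spread k (adj m) (iota 0 n)]
  else [:: [::]].

Lemma mem_spread_codes (G : sgraph) (k : nat) (s : seq G) :
  uniq s -> spread k (@sedge G) s -> code s \in spread_codes k (size s).
Proof.
elim: s => // x s IHs /= us sp; have /andP[_ us'] := us.
rewrite mem_filter; apply/andP; split; first by rewrite (@spread_code G k (x :: s)).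
apply: allpairs_f; last by rewrite -(size_map (sedge x)) mem_bitseqs.
exact: IHs us' (spread_behead sp).
Qed.

(** * Isomorphism by exhaustive relabelling *)

Definition matches (e : rel nat) (H : sgraph) (t : seq H) : bool :=
  has (fun p => all2 (fun i x => all2 (fun j y => e i j == sedge x y) p t) p t)
    (permutations (iota 0 (size t))).

Lemma all2_nth (S T : Type) (r : S -> T -> bool) (x0 : S) (y0 : T)
    (s : seq S) (t : seq T) (i : nat) :
  all2 r s t -> i < size s -> r (nth x0 s i) (nth y0 t i).
Proof. by elim: s t i => [|x s IHs] [|y t] [|i] //= /andP[rxy rst]; auto. Qed.

Lemma isomorphic_enum (G H : sgraph) (x0 : G) (y0 : H) (s : seq G) (t : seq H) :
  uniq s -> size s = #|G| -> uniq t -> size t = #|H| -> size s = size t ->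
  (forall i j, i < size s -> j < size s ->
     sedge (nth x0 s i) (nth x0 s j) = sedge (nth y0 t i) (nth y0 t j)) ->
  isomorphic G H.
Proof.
move=> us szs ut szt szst E.
have ins (x : G) : x \in s by rewrite (uniq_size_mem us szs).
have int (y : H) : y \in t by rewrite (uniq_size_mem ut szt).
exists (fun x => nth y0 t (index x s)).
  exists (fun y => nth x0 s (index y t)) => [x | y].
    by rewrite index_uniq ?nth_index // -szst index_mem.
  by rewrite index_uniq ?nth_index // szst index_mem.
by move=> x y; rewrite -E ?index_mem // !nth_index.
Qed.

Lemma matches_isomorphic (n : nat) (G H : sgraph) (t : seq H) :
  #|G| = n.+1 -> #|H| = n.+1 -> uniq t -> size t = n.+1 ->
  matches (adj (code (enum G))) t -> isomorphic G H.
Proof.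
move=> szG szH ut szt /hasP[p]; rewrite mem_permutations => perm_p mp.
set s := enum G in mp; have us : uniq s := enum_uniq G.
have szs : size s = #|G| by rewrite -cardE.
have szst : size s = size t by rewrite szs szG.
have szp : size p = size t by rewrite (perm_size perm_p) size_iota.
(* The cardinality [n.+1] provides default vertices for [nth]. *)
have [x0 _] : exists x0 : G, x0 \in G by apply/card_gt0P; rewrite szG.
have [y0 _] : exists y0 : H, y0 \in H by apply/card_gt0P; rewrite szH.
have ltp i : i < size p -> nth 0 p i < size s.
  by move=> /(mem_nth 0); rewrite (perm_mem perm_p) mem_iota szst.
(* Reading [s] in the order [p] gives the enumeration of [G] to be aligned with [t]. *)
have perm_s : perm_eq (map (nth x0 s) p) s.
  by rewrite -[X in perm_eq _ X](mkseq_nth x0) szst; apply: perm_map.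
apply: (isomorphic_enum (x0 := x0) (y0 := y0) (s := map (nth x0 s) p) (t := t)) => //.
- by rewrite (perm_uniq perm_s).
- by rewrite (perm_size perm_s).
- by rewrite szt szH.
- by rewrite size_map.
move=> i j; rewrite size_map => lti ltj; rewrite !(nth_map 0) //.
rewrite -adj_code ?ltp //.
exact/eqP/(all2_nth 0 y0 (all2_nth 0 y0 mp lti) ltj).
Qed.

Lemma Gr_code (n k : nat) (G : sgraph) :
  Gr n k G -> code (enum G) \in spread_codes k n.
Proof.
case=> <- idG; rewrite cardE.
by apply: mem_spread_codes; rewrite ?enum_uniq ?identifying_spread ?enum_uniq.
Qed.

(** * The computations for k = 4 *)

(** Any six vertices of [G] already give a code in [spread_codes 4 6], so one computation handles
    every [n]. *)
Lemma Gr_4_empty (n : nat) (G : sgraph) : 6 <= n -> ~ Gr n 4 G.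
Proof.
move=> len [szG idG]; have us := take_uniq 6 (enum_uniq G).
have sz6 : size (take 6 (enum G)) = 6 by rewrite size_takel -?cardE ?szG.
have := mem_spread_codes us (identifying_spread idG us); rewrite sz6.
by have -> : spread_codes 4 6 = [::] by vm_compute.
Qed.

Definition C4_enum : seq (cycle_graph 4) :=
  [:: @Ordinal 4 0 isT; @Ordinal 4 1 isT; @Ordinal 4 2 isT; @Ordinal 4 3 isT].

(** The carriers of both graphs are ['I_4], so the list is reused by conversion; its new type
    selects the other edge relation. *)
Definition P4_enum : seq (path_graph 4) := C4_enum.

Definition E4_enum : seq (edgeless_graph 4) := C4_enum.

Definition C5_enum : seq (cycle_graph 5) :=
  [:: @Ordinal 5 0 isT; @Ordinal 5 1 isT; @Ordinal 5 2 isT; @Ordinal 5 3 isT;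
      @Ordinal 5 4 isT].

Definition K13_enum : seq (star_graph 3) :=
  [:: inl (@Ordinal 1 0 isT); inr (@Ordinal 3 0 isT); inr (@Ordinal 3 1 isT);
      inr (@Ordinal 3 2 isT)].

Definition P3E1_enum : seq (disjoint_union (path_graph 3) (edgeless_graph 1)) :=
  [:: inl (@Ordinal 3 0 isT); inl (@Ordinal 3 1 isT); inl (@Ordinal 3 2 isT);
      inr (@Ordinal 1 0 isT)].

Definition K23_enum : seq (complete_bipartite 2 3) :=
  [:: inl (@Ordinal 2 0 isT); inl (@Ordinal 2 1 isT); inr (@Ordinal 3 0 isT);
      inr (@Ordinal 3 1 isT); inr (@Ordinal 3 2 isT)].

Definition K14_enum : seq (star_graph 4) :=
  [:: inl (@Ordinal 1 0 isT); inr (@Ordinal 4 0 isT); inr (@Ordinal 4 1 isT);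
      inr (@Ordinal 4 2 isT); inr (@Ordinal 4 3 isT)].

Definition C4_pendant_enum (v : cycle_graph 4) : seq (attach_pendant v) :=
  None :: map Some C4_enum.

Lemma codes_4_4 :
  all (fun m =>
    [|| matches (adj m) C4_enum, matches (adj m) P4_enum, matches (adj m) K13_enum,
        matches (adj m) E4_enum | matches (adj m) P3E1_enum])
    (spread_codes 4 4).
Proof. by vm_compute. Qed.

(** Since the 4-cycle is vertex-transitive, attaching the pendant vertex at 0 represents all four
    choices. *)
Lemma codes_5_4 :
  all (fun m =>
    [|| matches (adj m) C5_enum, matches (adj m) K23_enum, matches (adj m) K14_enum
      | matches (adj m) (C4_pendant_enum (@Ordinal 4 0 isT))])
    (spread_codes 4 5).
Proof. by vm_compute. Qed.

Lemma Gr_C5 : Gr 5 4 (cycle_graph 5).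
Proof. by apply: (@spread_Gr _ 4 C5_enum); rewrite ?card_ord //; vm_compute. Qed.

Theorem theorem17 :
  is_Xi 4 5 /\
  (forall (n : nat) (G : sgraph), 6 <= n -> ~ Gr n 4 G) /\
  (forall G : sgraph, Gr 4 4 G <->
     (isomorphic G (cycle_graph 4) \/
      isomorphic G (path_graph 4) \/
      isomorphic G (star_graph 3) \/
      isomorphic G (edgeless_graph 4) \/
      isomorphic G (disjoint_union (path_graph 3) (edgeless_graph 1)))) /\
  (forall G : sgraph, Gr 5 4 G <->
     (isomorphic G (cycle_graph 5) \/
      isomorphic G (complete_bipartite 2 3) \/
      isomorphic G (star_graph 4) \/
      (exists v : cycle_graph 4, isomorphic G (attach_pendant v)))).
Proof.
have spreadGr n (H : sgraph) (t : seq H) :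
    uniq t -> size t = n -> #|H| = n -> spread 4 (@sedge H) t -> Gr n 4 H.
  by move=> ut <- szH; apply: spread_Gr.
have card_pendant (v : cycle_graph 4) : #|attach_pendant v| = 5.
  by rewrite card_option card_ord.
split; first split.
- by split=> //; exists (cycle_graph 5); apply: Gr_C5.
- move=> n _ [G GrG]; rewrite leqNgt; apply/negP => lt5n; exact: Gr_4_empty lt5n GrG.
split; first exact: Gr_4_empty.
split=> G; split.
- move=> GrG; have [szG _] := GrG; have := allP codes_4_4 _ (Gr_code GrG).
  have iso := matches_isomorphic szG.
  case/or4P=> [mG|mG|mG|/orP[mG|mG]].
  + by left; apply: iso mG; rewrite ?card_ord.
  + by right; left; apply: iso mG; rewrite ?card_ord.
  + by do 2 right; left; apply: iso mG; rewrite ?card_sum ?card_ord.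
  + by do 3 right; left; apply: iso mG; rewrite ?card_ord.
  + by do 4 right; apply: iso mG; rewrite ?card_sum ?card_ord.
- case=> [|[|[|[|]]]] /isomorphic_Gr; apply.
  + by apply: (spreadGr _ _ C4_enum); rewrite ?card_ord //; vm_compute.
  + by apply: (spreadGr _ _ P4_enum); rewrite ?card_ord //; vm_compute.
  + by apply: (spreadGr _ _ K13_enum); rewrite ?card_sum ?card_ord //; vm_compute.
  + by apply: (spreadGr _ _ E4_enum); rewrite ?card_ord //; vm_compute.
  + by apply: (spreadGr _ _ P3E1_enum); rewrite ?card_sum ?card_ord //; vm_compute.
- move=> GrG; have [szG _] := GrG; have := allP codes_5_4 _ (Gr_code GrG).
  have iso := matches_isomorphic szG.
  case/or4P=> mG.
  + by left; apply: iso mG; rewrite ?card_ord.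
  + by right; left; apply: iso mG; rewrite ?card_sum ?card_ord.
  + by do 2 right; left; apply: iso mG; rewrite ?card_sum ?card_ord.
  + by do 3 right; exists (@Ordinal 4 0 isT); apply: iso mG; rewrite ?card_pendant.
- case=> [|[|[|[v]]]] /isomorphic_Gr; apply.
  + exact: Gr_C5.
  + by apply: (spreadGr _ _ K23_enum); rewrite ?card_sum ?card_ord //; vm_compute.
  + by apply: (spreadGr _ _ K14_enum); rewrite ?card_sum ?card_ord //; vm_compute.
  (* Here [v] is arbitrary, so the test is evaluated at each of the four vertices; the bound [lti]
     rules out the fifth branch. *)
  + by apply: (spreadGr _ _ (C4_pendant_enum v)) => //; case: v => [[|[|[|[|i]]]] lti].
Qed.
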